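(* Let $\mathbb{X}$ be a complex Banach space, let $B$ be any bounded (continuous) linear operator on $\mathbb{X}$ such that $\sigma(B)\cap\Gamma\subset\{1\}$, where $\Gamma=\{z\in\mathbb{C}:|z|=1\}$, and let $(y(n))_{n=1}^\infty$ be a sequence in $\mathbb{X}$ with $\lim_{n\to\infty}y(n)=0$. Let $(x(n))_{n=1}^\infty$ be a bounded sequence in $\mathbb{X}$ satisfying $$x(n+1)=Bx(n)+y(n)\quad\text{for all } n\in\mathbb{N}=\{1,2,\dots\}.$$ Then $$\lim_{n\to\infty}[x(n+1)-x(n)]=0.$$
   Context: $\sigma(B)$ denotes the spectrum of $B$. The operator $B$ is not assumed to be power-bounded. Limits are in the norm of $\mathbb{X}$. *)

(* Defs.v *)
From HB Require Import structures.
From mathcomp Require Import all_boot all_order all_algebra.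
From mathcomp Require Import complex.
From mathcomp Require Import all_classical all_reals.
From mathcomp Require Import topology normedtype sequences.

Set Implicit Arguments.
Unset Strict Implicit.
Unset Printing Implicit Defensive.

Import Order.TTheory GRing.Theory Num.Theory.
Import numFieldNormedType.Exports.

Local Open Scope classical_set_scope.
Local Open Scope ring_scope.
Local Open Scope complex_scope.

(** Invertibility in the algebra of bounded operators: the inverse is itself
    required to be linear and continuous. *)
Definition bounded_invertible (R : realType) (X : normedModType R[i])
    (T : X -> X) : Prop :=
  exists S : {linear X -> X}, [/\ continuous S, cancel T S & cancel S T].

Definition spectrum (R : realType) (X : normedModType R[i]) (B : X -> X) :
    set R[i] :=
  [set z | ~ bounded_invertible (fun v : X => z *: v - B v)].

Definition unit_circle (R : realType) : set R[i] := [set z | `|z| = 1].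
Arguments unit_circle : clear implicits.

(* Main.v *)
Require Import Defs.
From HB Require Import structures.
From mathcomp Require Import all_boot all_order all_algebra.
From mathcomp Require Import complex.
From mathcomp Require Import all_classical all_reals.
From mathcomp Require Import topology normedtype sequences.
From mathcomp Require Import ring lra.

Set Implicit Arguments.
Unset Strict Implicit.
Unset Printing Implicit Defensive.

Import Order.TTheory GRing.Theory Num.Theory.
Import numFieldNormedType.Exports.

Local Open Scope classical_set_scope.
Local Open Scope ring_scope.
Local Open Scope complex_scope.

(* Let S be the shift on bounded sequences modulo null sequences: an isometry
    for the seminorm limsup |u n|. On the S-invariant subspace of the sequences
    u with S u = B u modulo null sequences, which contains x, the operator
    l - S is invertible for |l| <> 1 because S is isometric, and for |l| = 1,
    l <> 1 because there its inverse is (l - B)^-1. So the theorem follows from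
    Gelfand's: an isometry S with spectrum {1} is the identity. For that, put
    N = S - 1 and F(w) = (w - N)^-1 x, which is analytic off 0 and O(1/|w|) at
    infinity. The polynomial q(w) = w^2 + r^2 w + r^2 satisfies
    |q(w)| = r ||1 + w|^2 - 1| on |w| = r, so |q(w) F(w)| <= r (2 + r) |x| there,
    as |F(w)| <= |x| / ||1 + w| - 1|. On the other hand
    q(w) F(w) = (w + N + r^2) x + (w - N)^-1 q(N) x, and by Cauchy's theorem the
    last term has mean 0 over |w| = r. Hence |N x + r^2 x| <= r (2 + r) |x|, and
    r tends to 0. Cauchy's theorem is obtained without integrals, by comparing
    averages over roots of unity on neighbouring circles. *)

Section RealNorm.
Variable R : realType.

Definition nm (V : normedZmodType R[i]) (x : V) : R := complex.Re `|x|.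

Lemma nmE (V : normedZmodType R[i]) (x : V) : `|x| = (nm x)%:C.
Proof. by rewrite /nm RRe_real // normr_real. Qed.

Lemma nm_ge0 (V : normedZmodType R[i]) (x : V) : 0 <= nm x.
Proof. by rewrite -lecR -nmE normr_ge0. Qed.

Lemma nm0 (V : normedZmodType R[i]) : nm (0 : V) = 0.
Proof. by rewrite /nm normr0. Qed.

Lemma nmN (V : normedZmodType R[i]) (x : V) : nm (- x) = nm x.
Proof. by rewrite /nm normrN. Qed.

Lemma nmD (V : normedZmodType R[i]) (x y : V) : nm (x + y) <= nm x + nm y.
Proof. by rewrite -lecR rmorphD /= -!nmE ler_normD. Qed.

Lemma nmZ (V : normedModType R[i]) (a : R[i]) (x : V) :
  nm (a *: x) = nm a * nm x.
Proof. by apply: complexI; rewrite rmorphM /= -!nmE normrZ. Qed.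

Lemma nmM (a b : R[i]) : nm (a * b) = nm a * nm b.
Proof. by apply: complexI; rewrite rmorphM /= -!nmE normrM. Qed.

Lemma nmX (a : R[i]) n : nm (a ^+ n) = nm a ^+ n.
Proof. by apply: complexI; rewrite rmorphXn /= -!nmE normrX. Qed.

Lemma nmV (a : R[i]) : nm a^-1 = (nm a)^-1.
Proof. by apply: complexI; rewrite fmorphV /= -!nmE normfV. Qed.

Lemma nmR (a : R) : nm a%:C = `|a|.
Proof. by rewrite /nm normc_def /= expr0n addr0 sqrtr_sqr. Qed.

Lemma nm1 : nm (1 : R[i]) = 1.
Proof. by rewrite (nmR 1) normr1. Qed.

Lemma nm_eq0 (a : R[i]) : (nm a == 0) = (a == 0).
Proof. by rewrite -(inj_eq (@complexI R)) -nmE normr_eq0. Qed.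

Lemma nm_gt0 (a : R[i]) : (0 < nm a) = (a != 0).
Proof. by rewrite lt_def nm_eq0 nm_ge0 andbT. Qed.

Lemma nm_sqr (a b : R) : nm (a +i* b) ^+ 2 = a ^+ 2 + b ^+ 2.
Proof. by rewrite /nm normc_def /= sqr_sqrtr// addr_ge0// sqr_ge0. Qed.

Lemma nm_cart_le (a b : R) : nm (a +i* b) <= `|a| + `|b|.
Proof.
rewrite -(ler_pXn2r (n := 2)) ?nnegrE ?nm_ge0 ?addr_ge0 //.
rewrite nm_sqr sqrrD !real_normK ?num_real // lerD2r lerDl.
by rewrite mulrn_wge0 // mulr_ge0.
Qed.

(* A square root of a + ib with nonnegative real part s satisfies
   1 - s = (1 - a) / (2 (1 + s)), so halving the angle halves 1 - Re. *)
Lemma root_of_unity_near1 (m : nat) : exists w : R[i],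
  [/\ w ^+ (2 ^ m.+1) = 1, w != 1, nm w = 1 & 1 - complex.Re w <= 2 / 2 ^+ m].
Proof.
elim: m => [|m [w [wX w1 nw hw]]].
  exists (-1); split; rewrite ?expn1 ?sqrrN ?expr1n ?nmN ?nm1 //.
    by rewrite -subr_eq0 -opprD oppr_eq0 -mulr2n pnatr_eq0.
  by rewrite /= expr0; lra.
have [z [zE z0]] : exists z : R[i], z ^+ 2 = w /\ 0 <= complex.Re z.
  have [h|h] := leP 0 (complex.Re (sqrtc w)).
    by exists (sqrtc w); rewrite sqr_sqrtc.
  exists (- sqrtc w); rewrite sqrrN sqr_sqrtc; split => //.
  by case: (sqrtc w) h => a b /= h; rewrite oppr_ge0 ltW.
have nz : nm z = 1.
  apply/eqP; rewrite -(@eqrXn2 _ 2) ?nm_ge0 // -nmX zE nw expr1n //.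
exists z; split => //.
- by rewrite expnS exprM zE.
- by apply: contraNneq w1 => z1; rewrite -zE z1 expr1n.
have := nm_sqr (complex.Re z) (complex.Im z).
have : complex.Re w = complex.Re z ^+ 2 - complex.Im z ^+ 2.
  by rewrite -zE; case: (z) => a b; rewrite !expr2.
have -> : complex.Re z +i* complex.Im z = z by case: (z).
rewrite nz (exprSr _ m) invfM => wE abE.
have : 2 * (1 - complex.Re z) * (1 + complex.Re z) = 1 - complex.Re w.
  rewrite wE; lra.
have : 0 <= 1 - complex.Re z.
  have := sqr_ge0 (complex.Im z); nra.
set t := 2 ^+ m in hw *; move: hw; set u := t^-1.
nra.
Qed.

Lemma nm_sub1 (w : R[i]) : nm w = 1 -> nm (w - 1) ^+ 2 = 2 * (1 - complex.Re w).
Proof.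
case: w => a b nw; have := nm_sqr a b; rewrite nw => h.
have -> : a +i* b - 1 = (a - 1) +i* b.
  by apply/eqP; rewrite eq_complex /= subr0 !eqxx.
by rewrite nm_sqr /=; lra.
Qed.

Lemma root_of_unity_close (e : R) : 0 < e -> exists (n : nat) (w : R[i]),
  [/\ (0 < n)%N, w ^+ n = 1, w != 1, nm w = 1 & nm (w - 1) <= e].
Proof.
move=> e0.
have [m hm] : exists m, 4 / 2 ^+ m <= e ^+ 2.
  have e20 : 0 < e ^+ 2 by rewrite exprn_gt0.
  pose m := (Num.truncn (4 / e ^+ 2)).+1; exists m.
  rewrite ler_pdivrMr ?exprn_gt0 // mulrC -ler_pdivrMr //.
  have h1 : 4 / e ^+ 2 < m%:R by rewrite truncnS_gt.
  apply: (le_trans (ltW h1)).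
  by rewrite -natrX ler_nat ltnW // ltn_expl.
have [w [wX w1 nw hw]] := root_of_unity_near1 m.
exists (2 ^ m.+1)%N, w; split=> //; first by rewrite expn_gt0.
rewrite -(ler_pXn2r (n := 2)) ?nnegrE ?nm_ge0 ?(ltW e0) //.
by rewrite nm_sub1 //; lra.
Qed.

Lemma sum_root_of_unity (n : nat) (w : R[i]) : w ^+ n = 1 -> w != 1 ->
  \sum_(k < n) w ^+ k = 0.
Proof.
move=> wn w1; have := subrX1 w n; rewrite wn subrr => /esym/eqP.
by rewrite mulf_eq0 subr_eq0 (negbTE w1) => /eqP.
Qed.

Lemma sum_root_rot (V : zmodType) (n : nat) (w : R[i]) (g : R[i] -> V) :
  w ^+ n = 1 -> \sum_(k < n) g (w ^+ k.+1) = \sum_(k < n) g (w ^+ k).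
Proof.
move=> wn; apply: (addrI (g 1)).
have := big_ord_recl n (fun k : 'I_n.+1 => g (w ^+ k)) (idx := 0) (op := +%R).
rewrite big_ord_recr /= wn expr0 addrC => ->.
by [].
Qed.

End RealNorm.

(* [Q u c] plays the role of [p u <= c] for a seminorm [p] that is only
   defined on a subspace; [Q u c] also asserts that [u] lies in it. *)
Record seminorm_rel (R : realType) (V : lmodType R[i]) (Q : V -> R -> Prop) :
    Prop := SeminormRel {
  seminorm_rel0 : Q 0 0;
  seminorm_rel_ge0 : forall u c, Q u c -> 0 <= c;
  seminorm_relW : forall u c d, Q u c -> c <= d -> Q u d;
  seminorm_relD : forall u v c d, Q u c -> Q v d -> Q (u + v) (c + d);
  seminorm_relZ : forall a u c, Q u c -> Q (a *: u) (nm a * c);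
  seminorm_rel_closed : forall u c, (forall e, 0 < e -> Q u (c + e)) -> Q u c
}.

Section SeminormRel.
Variables (R : realType) (V : lmodType R[i]) (Q : V -> R -> Prop).
Hypothesis HQ : seminorm_rel Q.
Let QW := seminorm_relW HQ.
Let QD := seminorm_relD HQ.
Let QZ := seminorm_relZ HQ.

Lemma seminorm_relN u c : Q u c -> Q (- u) c.
Proof. by move=> /(QZ (- 1)); rewrite scaleN1r nmN nm1 mul1r. Qed.

Lemma seminorm_relB u v c d : Q u c -> Q v d -> Q (u - v) (c + d).
Proof. by move=> uc /seminorm_relN; exact: QD. Qed.

Lemma seminorm_rel_sum n (f : nat -> V) (c : R) :
  (forall k, Q (f k) c) -> Q (\sum_(k < n) f k) (n%:R * c).
Proof.
move=> h; elim: n => [|n IH].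
  by rewrite big_ord0 mul0r; exact: seminorm_rel0 HQ.
by rewrite big_ord_recr /= -natr1 mulrDl mul1r; exact: QD.
Qed.

Lemma seminorm_rel_contract v a t d : 0 <= t < 1 -> Q v d ->
  (forall e, Q v e -> Q v (a + t * e)) -> Q v (a / (1 - t)).
Proof.
move=> /andP[t0 t1] vd vt.
pose A := [set e | Q v e].
have Ai : has_inf A.
  by split; [exists d | exists 0 => e /(seminorm_rel_ge0 HQ)].
have QA : Q v (inf A).
  apply: (seminorm_rel_closed HQ) => e e0.
  have [x Ax xe] := inf_adherent e0 Ai.
  exact: QW Ax (ltW xe).
have : inf A <= a + t * inf A.
  by apply: ge_inf; [exact: Ai.2 | exact: vt].
move=> le; apply: QW QA _.
by rewrite ler_pdivlMr ?subr_gt0 //; lra.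
Qed.

Variable N : {linear V -> V}.

Definition bounded_below (w : R[i]) (K : R) :=
  forall v c d, Q v d -> Q (w *: v - N v) c -> Q v (K * c).

Lemma bounded_below_perturb (w z : R[i]) (K : R) : 0 <= K -> nm (z - w) * K <= 2^-1 ->
  bounded_below w K -> bounded_below z (2 * K).
Proof.
move=> K0 zw wK v c d vd zc.
have c0 := seminorm_rel_ge0 HQ zc.
have t0 : 0 <= K * nm (z - w) by rewrite mulr_ge0 // nm_ge0.
have t1 : K * nm (z - w) <= 2^-1 by rewrite mulrC.
have : Q v (K * c / (1 - K * nm (z - w))).
  apply: (@seminorm_rel_contract _ _ _ d) => //; first by rewrite t0 /=; lra.
  move=> e ve; rewrite -mulrA -mulrDr.
  apply: (wK _ _ _ ve).
  have -> : w *: v - N v = (z *: v - N v) - (z - w) *: v.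
    by rewrite scalerBl opprB [RHS]addrC addrA addrNK.
  by apply: seminorm_relB => //; exact: QZ.
move=> /QW; apply.
rewrite ler_pdivrMr; last lra.
have Kc : 0 <= K * c by rewrite mulr_ge0.
nra.
Qed.

Hypothesis bounded_below_ex : forall w, w != 0 ->
  exists2 K, 0 <= K & bounded_below w K.

Lemma bounded_below_annulus r s : 0 < r -> exists2 K, 0 <= K &
  forall w, r <= nm w <= s -> bounded_below w K.
Proof.
move=> r0.
pose D : set (R * R) := `[- s, s]%classic `*` `[- s, s]%classic `&`
  [set p | r ^+ 2 <= p.1 ^+ 2 + p.2 ^+ 2].
have cD : compact D.
  apply: compact_closedI; first by apply: compact_setX; exact: segment_compact.
  apply: (@preimage_closed _ _ (fun p : R * R => p.1 ^+ 2 + p.2 ^+ 2)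
    [set x | r ^+ 2 <= x]); last exact: closed_ge.
  by move=> p _; apply: cvgD; apply: cvgM; (exact: cvg_fst || exact: cvg_snd).
have /compact_near_coveringP/(_ R +oo
  (fun K (p : R * R) => bounded_below (p.1 +i* p.2) K)) := cD.
have step : forall p, D p -> \forall p' \near p & K \near +oo,
    bounded_below (p'.1 +i* p'.2) K.
  move=> [a b] [_ /= abr].
  have ab0 : a +i* b != 0.
    by rewrite -nm_gt0 -(@ltr_pXn2r _ 2) ?nnegrE ?nm_ge0 // nm_sqr expr0n /=
       (lt_le_trans _ abr) // exprn_gt0.
  have [K K0 hK] := bounded_below_ex ab0.
  pose e := (4 * (K + 1))^-1.
  have e0 : 0 < e by rewrite invr_gt0; lra.
  exists (ball (a, b) e, [set M | 2 * K <= M]).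
    split => /=; first exact: nbhsx_ballx.
    by exists (2 * K); split; [exact: num_real | move=> M /ltW].
  move=> [[a' b'] M] /= [[/= aa bb] KM] v c d vd vc.
  have c0 := seminorm_rel_ge0 HQ vc.
  apply: QW (ler_wpM2r c0 KM).
  apply: bounded_below_perturb hK _ _ _ vd vc => //.
  have -> : a' +i* b' - (a +i* b) = (a' - a) +i* (b' - b) by [].
  have := nm_cart_le (a' - a) (b' - b).
  move: aa bb; rewrite /ball /= distrC => aa; rewrite distrC => bb le.
  have h : nm ((a' - a) +i* (b' - b)) <= 2 * e by lra.
  have eK : 4 * e * (K + 1) = 1 by rewrite /e; field; lra.
  have := nm_ge0 ((a' - a) +i* (b' - b)); nra.
move=> /(_ _ step) [M [_ hM]].
exists (Num.max 0 M + 1); first by rewrite addr_ge0 // le_max lexx.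
have MM : M < Num.max 0 M + 1.
  by rewrite ltr_pwDr // le_max lexx orbT.
case=> a b /andP[rw ws]; apply: (hM _ MM (a, b)).
have s0 : 0 <= s by exact: le_trans (nm_ge0 _) ws.
have ab := nm_sqr a b.
have le2 : a ^+ 2 + b ^+ 2 <= s ^+ 2.
  by rewrite -ab ler_pXn2r ?nnegrE ?nm_ge0.
have a2 := sqr_ge0 a; have b2 := sqr_ge0 b.
split; [split => /=; rewrite in_itv /= -ler_norml | rewrite /= -ab].
- by rewrite -(ler_pXn2r (n := 2)) ?nnegrE // real_normK ?num_real //; lra.
- by rewrite -(ler_pXn2r (n := 2)) ?nnegrE // real_normK ?num_real //; lra.
- by rewrite ler_pXn2r ?nnegrE ?nm_ge0 ?(ltW r0).
Qed.

End SeminormRel.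

Section Resolvent.
Variables (R : realType) (V : lmodType R[i]) (Q : V -> R -> Prop).
Hypothesis HQ : seminorm_rel Q.
Variable N : {linear V -> V}.
(* With S = 1 + N one has w - N = (1 + w) - S, and this is the bound that
   holds when S is an isometry. *)
Hypothesis bounded_below_off1 : forall w, nm (1 + w) != 1 ->
  bounded_below Q N w (`|nm (1 + w) - 1|^-1).
Hypothesis bounded_below_on1 : forall w, nm (1 + w) = 1 -> w != 0 ->
  exists2 K, 0 <= K & bounded_below Q N w K.
Hypothesis solvable : forall w u c, w != 0 -> Q u c ->
  exists v d, Q v d /\ Q (w *: v - N v - u) 0.
Hypothesis N_bounded : forall u c, Q u c -> exists d, Q (N u) d.
Let QW := seminorm_relW HQ.
Let QD := seminorm_relD HQ.
Let QZ := seminorm_relZ HQ.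

Let bounded_below_ex w : w != 0 -> exists2 K, 0 <= K & bounded_below Q N w K.
Proof.
move=> w0; have [|] := eqVneq (nm (1 + w)) 1.
  by move=> /bounded_below_on1; exact.
by move=> /bounded_below_off1; exists `|nm (1 + w) - 1|^-1; rewrite ?invr_ge0.
Qed.

Let T w v := w *: v - N v.

Let TB w u v : T w (u - v) = T w u - T w v.
Proof. by rewrite /T scalerBr linearB /= opprD addrACA -opprD. Qed.

Let TZ w a v : T w (a *: v) = a *: T w v.
Proof. by rewrite /T [N _]linearZ scalerBr !scalerA [a * w]mulrC. Qed.

Let TD w u v : T w (u + v) = T w u + T w v.
Proof. by rewrite /T scalerDr linearD /= opprD addrACA. Qed.

Let TDl w h v : T (w + h) v = T w v + h *: v.
Proof. by rewrite /T scalerDl addrAC. Qed.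

(* The values of w |-> (w - N)^-1 u, up to elements of seminorm 0. *)
Definition resolvent_at (u : V) (F : R[i] -> V) := forall w, w != 0 ->
  (exists d, Q (F w) d) /\ Q (w *: F w - N (F w) - u) 0.

Lemma resolvent_at_ex u c : Q u c -> exists F, resolvent_at u F.
Proof.
move=> uc.
have /choice[F hF] : forall w, exists v, w != 0 ->
    (exists d, Q v d) /\ Q (w *: v - N v - u) 0.
  move=> w; have [->|w0] := eqVneq w 0; first by exists 0.
  by have [v [d [vd h]]] := solvable w0 uc; exists v => _; split => //; exists d.
by exists F => w w0; exact: hF.
Qed.

Lemma resolvent_at_bound u F w K c : resolvent_at u F -> w != 0 ->
  bounded_below Q N w K -> Q u c -> Q (F w) (K * c).
Proof.
move=> hF w0 hK uc; have [[d Fd] h] := hF w w0.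
apply: (hK _ _ _ Fd).
by have := QD h uc; rewrite addrNK add0r.
Qed.

Lemma resolvent_expansion u F (G : R[i] -> V) w h K c :
  resolvent_at u F -> Q u c -> w != 0 -> w + h != 0 -> 0 <= K ->
  bounded_below Q N w K -> bounded_below Q N (w + h) K ->
  (exists d, Q (G w) d) -> Q (w *: G w - N (G w) - F w) 0 ->
  Q (F (w + h) - F w + h *: G w) (K ^+ 3 * c * nm h ^+ 2).
Proof.
move=> hF uc w0 wh0 K0 hK hKh [g Gg] hG.
have Fwh := resolvent_at_bound hF wh0 hKh uc.
have Fw := resolvent_at_bound hF w0 hK uc.
have [_ n1] := hF _ wh0; have [_ n2] := hF _ w0.
have TFB : T w (F (w + h) - F w) =
    (T (w + h) (F (w + h)) - u) - (T w (F w) - u) - h *: F (w + h).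
  have cancel (a b d e : V) : a - b = a + d - e - (b - e) - d.
    by rewrite opprB addrA addrNK [RHS]addrAC addrK.
  by rewrite TB TDl; exact: cancel.
have FB : Q (F (w + h) - F w) (K * (nm h * (K * c))).
  apply: (hK _ _ _ (seminorm_relB HQ Fwh Fw)).
  rewrite -/(T _ _) TFB -[X in Q _ X]add0r -[X in Q _ (X + _)]addr0.
  apply: (seminorm_relB HQ); last exact: QZ.
  exact: (seminorm_relB HQ).
suff : Q (F (w + h) - F w + h *: G w) (K * (nm h * (K * (nm h * (K * c))))).
  by move=> /QW; apply; lra.
apply: (hK _ _ _ (QD (seminorm_relB HQ Fwh Fw) (QZ h Gg))).
have TE : T w (F (w + h) - F w + h *: G w) =
    (T (w + h) (F (w + h)) - u) - (T w (F w) - u) + h *: (T w (G w) - F w)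
    - h *: (F (w + h) - F w).
  have cancel (a b d e : V) : a - b + d = a + (d - e) - (b - e).
    by rewrite opprB !addrA addrNK addrAC.
  by rewrite TD TFB TZ !scalerBr; exact: cancel.
rewrite -/(T _ _) TE.
have q0 : Q (T (w + h) (F (w + h)) - u - (T w (F w) - u)
    + h *: (T w (G w) - F w)) (0 + 0 + nm h * 0).
  by apply: QD; [exact: (seminorm_relB HQ) | exact: QZ].
by move: (seminorm_relB HQ q0 (QZ h FB)); rewrite mulr0 !add0r.
Qed.

Section CircleSums.
Variables (u : V) (F G : R[i] -> V) (c K r s : R) (w : R[i]) (n : nat).
Hypotheses (hF : resolvent_at u F) (uc : Q u c) (K0 : 0 <= K) (r0 : 0 < r).
Hypothesis hK : forall z, r <= nm z <= s -> bounded_below Q N z K.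
Hypothesis hG : forall z, z != 0 ->
  (exists d, Q (G z) d) /\ Q (z *: G z - N (G z) - F z) 0.
Hypotheses (wn : w ^+ n = 1) (w1 : w != 1) (nw : nm w = 1).

Definition circle_sum (t : R) := \sum_(k < n) F (t%:C * w ^+ k).

Let nmc t k : 0 <= t -> nm (t%:C * w ^+ k) = t.
Proof. by move=> t0; rewrite nmM nmR nmX nw expr1n mulr1 ger0_norm. Qed.

Lemma circle_sum_step t d : r <= t -> 0 <= d -> t + d <= s ->
  Q (circle_sum (t + d) - circle_sum t)
    (n%:R * (K ^+ 3 * c * (d * (d + s * nm (w - 1))))).
Proof.
move=> rt d0 tds.
have t0 : 0 < t by exact: lt_le_trans rt.
have c0 := seminorm_rel_ge0 HQ uc.
have C0 : 0 <= K ^+ 3 * c by rewrite mulr_ge0 ?exprn_ge0.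
have e0 := nm_ge0 (w - 1).
set C := K ^+ 3 * c in C0 *.
have expansion z h : r <= nm z <= s -> r <= nm (z + h) <= s ->
    Q (F (z + h) - F z + h *: G z) (C * nm h ^+ 2).
  move=> hz hzh.
  have z0 : z != 0 by rewrite -nm_gt0 (lt_le_trans r0) //; case/andP: hz.
  have zh0 : z + h != 0 by rewrite -nm_gt0 (lt_le_trans r0) //; case/andP: hzh.
  by have [h1 h2] := hG z0; apply: (resolvent_expansion hF uc) => //; exact: hK.
have inr k : r <= nm (t%:C * w ^+ k) <= s.
  by rewrite nmc ?(ltW t0) // rt /=; lra.
pose H := \sum_(k < n) w ^+ k *: G (t%:C * w ^+ k).
have tw0 : t%:C * (w - 1) != 0.
  by rewrite mulf_neq0 ?subr_eq0 // -nm_gt0 nmR gtr0_norm.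
have HE : Q H (n%:R * (C * (t * nm (w - 1)))).
  have : Q ((t%:C * (w - 1)) *: H) (n%:R * (C * (t * nm (w - 1)) ^+ 2)).
    have -> : (t%:C * (w - 1)) *: H = \sum_(k < n)
        (F (t%:C * w ^+ k.+1) - F (t%:C * w ^+ k)
         + (t%:C * (w - 1) * w ^+ k) *: G (t%:C * w ^+ k)).
      rewrite big_split sumrB /= (@sum_root_rot _ _ _ _ (fun z => F (t%:C * z))) //.
      rewrite subrr add0r scaler_sumr; apply: eq_bigr => k _.
      by rewrite scalerA.
    apply: (@seminorm_rel_sum _ _ _ HQ n (fun k => F (t%:C * w ^+ k.+1)
        - F (t%:C * w ^+ k) + (t%:C * (w - 1) * w ^+ k) *: G (t%:C * w ^+ k)) _).
    move=> k.
    have E : t%:C * w ^+ k.+1 = t%:C * w ^+ k + t%:C * (w - 1) * w ^+ k.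
      by rewrite exprS; ring.
    have hE : nm (t%:C * (w - 1) * w ^+ k) = t * nm (w - 1).
      by rewrite !nmM nmX nw expr1n mulr1 nmR gtr0_norm.
    have := expansion (t%:C * w ^+ k) (t%:C * (w - 1) * w ^+ k) (inr k).
    by rewrite -E hE; apply; exact: inr.
  move=> /(QZ (t%:C * (w - 1))^-1); rewrite scalerA mulVf // scale1r.
  move=> /QW; apply.
  rewrite nmV nmM nmR gtr0_norm //.
  have dw : 0 < nm (w - 1) by rewrite nm_gt0 subr_eq0.
  by rewrite le_eqVlt; apply/orP; left; apply/eqP; field; rewrite !gt_eqF.
have -> : circle_sum (t + d) - circle_sum t = \sum_(k < n)
    (F (t%:C * w ^+ k + d%:C * w ^+ k) - F (t%:C * w ^+ k)
     + (d%:C * w ^+ k) *: G (t%:C * w ^+ k)) - d%:C *: H.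
  rewrite big_split /= sumrB scaler_sumr.
  under [X in _ + X - _]eq_bigr do rewrite -scalerA.
  rewrite addrK /circle_sum; congr (_ - _); apply: eq_bigr => k _.
  by rewrite rmorphD mulrDl.
have q1 : Q (\sum_(k < n)
    (F (t%:C * w ^+ k + d%:C * w ^+ k) - F (t%:C * w ^+ k)
     + (d%:C * w ^+ k) *: G (t%:C * w ^+ k))) (n%:R * (C * d ^+ 2)).
  apply: (@seminorm_rel_sum _ _ _ HQ n (fun k => F (t%:C * w ^+ k + d%:C * w ^+ k)
     - F (t%:C * w ^+ k) + (d%:C * w ^+ k) *: G (t%:C * w ^+ k)) _) => k.
  have := expansion (t%:C * w ^+ k) (d%:C * w ^+ k) (inr k).
  rewrite -mulrDl -rmorphD /= !nmc ?addr_ge0 ?(ltW t0) //; apply.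
  by rewrite tds andbT; lra.
apply: QW (seminorm_relB HQ q1 (QZ d%:C HE)) _.
rewrite nmR ger0_norm //.
have Cn : 0 <= n%:R * C by rewrite mulr_ge0.
have : 0 <= d * nm (w - 1) * (s - t) by rewrite !mulr_ge0 //; lra.
nra.
Qed.

Lemma circle_sum_annulus m : r <= s -> (0 < m)%N ->
  Q (circle_sum s - circle_sum r)
    (n%:R * (K ^+ 3 * c * ((s - r) * ((s - r) / m%:R + s * nm (w - 1))))).
Proof.
move=> rs m0; set d := (s - r) / m%:R.
have mR : 0 < m%:R :> R by rewrite ltr0n.
have d0 : 0 <= d by rewrite divr_ge0 ?subr_ge0 ?ler0n.
have md : m%:R * d = s - r by rewrite /d; field; rewrite gt_eqF.
have : forall j, (j <= m)%N -> Q (circle_sum (r + j%:R * d) - circle_sum r)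
    (j%:R * (n%:R * (K ^+ 3 * c * (d * (d + s * nm (w - 1)))))).
  elim=> [_|j IH jm].
    by rewrite mul0r addr0 subrr mul0r; exact: seminorm_rel0 HQ.
  have jmd : j.+1%:R * d <= m%:R * d by rewrite ler_wpM2r // ler_nat.
  have := @circle_sum_step (r + j%:R * d) d.
  have -> : r + j%:R * d + d = r + j.+1%:R * d by rewrite -natr1; ring.
  have jd : 0 <= j%:R * d by rewrite mulr_ge0.
  move=> /(_ _ d0 _)/= h; have {}h := h ltac:(lra) ltac:(lra).
  have := QD h (IH (ltnW jm)); rewrite addrA addrNK.
  by move=> /QW; apply; rewrite -[j.+1%:R]natr1; lra.
move=> /(_ m (leqnn m)); rewrite md addrCA subrr addr0.
move=> /QW; apply.
by rewrite -md; lra.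
Qed.

End CircleSums.

Lemma circle_sum_small u F c r e : resolvent_at u F -> Q u c -> 0 < r -> 0 < e ->
  exists (n : nat) (w : R[i]), [/\ (0 < n)%N, w ^+ n = 1, w != 1, nm w = 1 &
    Q (circle_sum F w n r) (n%:R * e)].
Proof.
move=> hF uc r0 e0; have c0 := seminorm_rel_ge0 HQ uc.
pose s := 2 + r + 2 * (c + 1) / e.
have s2 : r + 2 * (c + 1) / e = s - 2 by rewrite /s; lra.
have ce : 0 < 2 * (c + 1) / e by rewrite divr_gt0 //; lra.
have [K K0 hK] := bounded_below_annulus HQ bounded_below_ex s r0.
have /choice[G hG] : forall z, exists v, z != 0 ->
    (exists d, Q v d) /\ Q (z *: v - N v - F z) 0.
  move=> z; have [->|z0] := eqVneq z 0; first by exists 0.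
  have [[d Fd] _] := hF _ z0.
  by have [v [f [vd h]]] := solvable z0 Fd; exists v => _; split => //; exists f.
pose C := K ^+ 3 * c.
have C0 : 0 <= C by rewrite mulr_ge0 ?exprn_ge0.
have s0 : 0 < s by lra.
have Cs : 0 <= C * s ^+ 2 by rewrite mulr_ge0 ?sqr_ge0.
pose eta := e / (4 * (C * s ^+ 2 + 1)).
have eta0 : 0 < eta by rewrite divr_gt0 //; lra.
have etaE : 4 * (C * s ^+ 2 + 1) * eta = e by rewrite /eta; field; lra.
have [n [w [n0 wn w1 nw hw]]] := root_of_unity_close eta0.
exists n, w; split => //.
pose m := (Num.truncn eta^-1).+1.
have m0 : 0 < m%:R :> R by rewrite ltr0n.
have meta : m%:R^-1 <= eta.
  by rewrite -[leRHS]invrK lef_pV2 ?posrE ?invr_gt0 // ltW // truncnS_gt.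
have rs : r <= s by lra.
have diff := circle_sum_annulus hF uc K0 r0 hK hG wn w1 nw rs (ltn0Sn _ : (0 < m)%N).
have outer : Q (circle_sum F w n s) (n%:R * (e / 2)).
  apply: (@seminorm_rel_sum _ _ _ HQ n (fun k => F (s%:C * w ^+ k)) _) => k.
  have nz : nm (s%:C * w ^+ k) = s.
    by rewrite nmM nmR nmX nw expr1n mulr1 gtr0_norm.
  set z := _ * _ in nz *.
  have z0 : z != 0 by rewrite -nm_gt0 nz.
  have := nmD (1 + z) (- 1); rewrite addrAC subrr add0r nz nmN nm1 => nz1.
  have z1 : nm (1 + z) != 1 by apply/eqP => h; lra.
  apply: QW (resolvent_at_bound hF z0 (bounded_below_off1 z1) uc) _.
  rewrite ger0_norm; last lra.
  rewrite mulrC ler_pdivrMr; last lra.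
  have : e / 2 * (2 * (c + 1) / e) <= e / 2 * (nm (1 + z) - 1).
    by rewrite ler_wpM2l //; lra.
  have -> : e / 2 * (2 * (c + 1) / e) = c + 1 by field; rewrite gt_eqF.
  lra.
have := seminorm_relB HQ outer diff; rewrite opprB addrC addrNK.
move=> /QW; apply; rewrite -mulrDr ler_wpM2l // -/C.
have h1 : (s - r) / m%:R + s * nm (w - 1) <= 2 * s * eta.
  have : (s - r) / m%:R <= s * eta.
    by apply: ler_pM; rewrite ?invr_ge0 ?ler0n //; lra.
  have : s * nm (w - 1) <= s * eta by rewrite ler_wpM2l // ltW.
  lra.
have h2 : (s - r) * ((s - r) / m%:R + s * nm (w - 1)) <= s * (2 * s * eta).
  apply: ler_pM => //; try lra.
  by rewrite addr_ge0 // ?divr_ge0 ?mulr_ge0 ?nm_ge0 ?(ltW m0) //; lra.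
have : C * ((s - r) * ((s - r) / m%:R + s * nm (w - 1))) <= C * (s * (2 * s * eta)).
  by rewrite ler_wpM2l.
nra.
Qed.

(* On |w| = r the quadratic q(w) = w^2 + r^2 w + r^2 equals
   w (w + conj w + r^2) = w (|1 + w|^2 - 1): it vanishes where the circle
   meets the unit circle around -1, which tames the resolvent there. *)
Let q (r : R) (w : R[i]) : R[i] := w ^+ 2 + (r ^+ 2)%:C * w + (r ^+ 2)%:C.

Let nm_q (r : R) (w : R[i]) : nm w = r ->
  nm (q r w) = r * `|nm (1 + w) ^+ 2 - 1|.
Proof.
move=> nw; have r2 : nm w ^+ 2 = r ^+ 2 by rewrite nw.
case: w nw r2 => a b nw; rewrite nm_sqr => r2.
have -> : q r (a +i* b) = (a +i* b) * (nm (1 + (a +i* b)) ^+ 2 - 1)%:C.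
  have -> : 1 + (a +i* b) = (1 + a) +i* b.
    by apply/eqP; rewrite eq_complex /= add0r !eqxx.
  rewrite nm_sqr /q -r2 expr2; apply/eqP; rewrite eq_complex /=.
  by apply/andP; split; apply/eqP; ring.
by rewrite nmM nw nmR.
Qed.

Lemma resolvent_at_q u F c (w : R[i]) r : resolvent_at u F -> Q u c ->
  0 < r -> nm w = r -> Q (q r w *: F w) (r * (2 + r) * c).
Proof.
move=> hF uc r0 nw; have c0 := seminorm_rel_ge0 HQ uc.
have w0 : w != 0 by rewrite -nm_gt0 nw.
have B0 : 0 <= r * (2 + r) * c by rewrite !mulr_ge0 //; lra.
have [w1|w1] := eqVneq (nm (1 + w)) 1.
  have [[d Fd] _] := hF w w0.
  apply: QW (QZ (q r w) Fd) _.
  by rewrite nm_q // w1 expr1n subrr normr0 mulr0 mul0r.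
apply: QW (QZ (q r w) (resolvent_at_bound hF w0 (bounded_below_off1 w1) uc)) _.
rewrite nm_q //.
have -> : nm (1 + w) ^+ 2 - 1 = (nm (1 + w) - 1) * (nm (1 + w) + 1) by ring.
rewrite normrM.
have h : `|nm (1 + w) - 1| != 0 by rewrite normr_eq0 subr_eq0.
rewrite [leLHS](_ : _ = r * `|nm (1 + w) + 1| * c); last by field.
rewrite ler_wpM2r // ler_wpM2l ?(ltW r0) // ger0_norm; last first.
  by rewrite addr_ge0 ?nm_ge0.
by have := nmD 1 w; rewrite nm1 nw; lra.
Qed.

Lemma resolvent_at_quotient u F c r : resolvent_at u F -> Q u c ->
  resolvent_at (N (N u) + (r ^+ 2)%:C *: N u + (r ^+ 2)%:C *: u)
    (fun w => q r w *: F w - (w *: u + (N u + (r ^+ 2)%:C *: u))).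
Proof.
move=> hF uc w w0; have [[d Fd] h] := hF w w0.
have [d' Nd] := N_bounded uc.
split.
  eexists; exact: (seminorm_relB HQ (QZ (q r w) Fd)
    (QD (QZ w uc) (QD Nd (QZ (r ^+ 2)%:C uc)))).
rewrite -/(T _ _) TB TZ.
have -> : T w (w *: u + (N u + (r ^+ 2)%:C *: u)) = q r w *: u
    - (N (N u) + (r ^+ 2)%:C *: N u + (r ^+ 2)%:C *: u).
  have cancel (a b a' e f g : V) :
      a - b + (b - a' + (e - f)) = a + e + g - (a' + f + g).
    rewrite [- (a' + f + g)]opprD [RHS]addrACA subrr addr0.
    by rewrite !addrA addrNK -addrA addrACA -opprD.
  rewrite !TD !TZ /T !scalerBr /q !scalerDl [w ^+ 2]expr2 -!scalerA.
  exact: cancel.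
have cancel (a b e : V) : a - (b - e) - e = a - b.
  by rewrite opprB addrA addrAC addrK.
rewrite cancel -scalerBr.
by have := QZ (q r w) h; rewrite mulr0.
Qed.

Lemma isometry_difference_le u c r : Q u c -> 0 < r ->
  Q (N u) (2 * (r + r ^+ 2) * c).
Proof.
move=> uc r0; have c0 := seminorm_rel_ge0 HQ uc.
have [F hF] := resolvent_at_ex uc.
suff Nr : Q (N u + (r ^+ 2)%:C *: u) (r * (2 + r) * c).
  have := seminorm_relB HQ Nr (QZ (r ^+ 2)%:C uc).
  by rewrite addrK nmR ger0_norm ?sqr_ge0 // => /QW; apply; lra.
apply: (seminorm_rel_closed HQ) => e e0.
have hF' := resolvent_at_quotient r hF uc.
set u' := (X in resolvent_at X _) in hF'.
set F' := (X in resolvent_at _ X) in hF'.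
have [c' u'c] : exists c', Q u' c'.
  have [d Nd] := N_bounded uc; have [d' NNd] := N_bounded Nd.
  eexists; exact: (QD (QD NNd (QZ (r ^+ 2)%:C Nd)) (QZ (r ^+ 2)%:C uc)).
have [n [w [n0 wn w1 nw small]]] := circle_sum_small hF' u'c r0 e0.
have nz k : nm (r%:C * w ^+ k) = r.
  by rewrite nmM nmR nmX nw expr1n mulr1 gtr0_norm.
have sumE : \sum_(k < n) q r (r%:C * w ^+ k) *: F (r%:C * w ^+ k)
    - circle_sum F' w n r = n%:R *: (N u + (r ^+ 2)%:C *: u).
  rewrite /circle_sum -sumrB /F'.
  under eq_bigr do rewrite opprB addrC addrNK.
  rewrite big_split /= -scaler_suml -mulr_sumr sum_root_of_unity //.
  by rewrite mulr0 scale0r add0r sumr_const card_ord scaler_nat.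
have := @seminorm_rel_sum _ _ _ HQ n
  (fun k => q r (r%:C * w ^+ k) *: F (r%:C * w ^+ k)) (r * (2 + r) * c).
move=> /(_ (fun k => resolvent_at_q hF uc r0 (nz k))) qsum.
have := seminorm_relB HQ qsum small; rewrite sumE -mulrDr.
have nR : n%:R != 0 :> R by rewrite pnatr_eq0 -lt0n.
have nC : n%:R != 0 :> R[i] by rewrite pnatr_eq0 -lt0n.
move=> /(QZ n%:R^-1); rewrite scalerA mulVf // scale1r nmV.
have -> : nm (n%:R : R[i]) = n%:R.
  by rewrite -(rmorph_nat (real_complex R)) /= nmR ger0_norm.
by rewrite mulrA mulVf // mul1r.
Qed.

(* Gelfand's theorem: an isometry S = 1 + N with spectrum {1} is the identity. *)
Lemma isometry_spectrum1 u c : Q u c -> Q (N u) 0.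
Proof.
move=> uc; have c0 := seminorm_rel_ge0 HQ uc.
apply: (seminorm_rel_closed HQ) => e e0; rewrite add0r.
pose r := Num.min 1 (e / (4 * (c + 1))).
have h0 : 0 < e / (4 * (c + 1)) by rewrite divr_gt0 //; lra.
have r0 : 0 < r by rewrite lt_min ltr01 h0.
apply: QW (isometry_difference_le uc r0) _.
have r1 : r <= 1 by rewrite ge_min lexx.
have : r * (4 * (c + 1)) <= e.
  by rewrite -ler_pdivlMr ?ge_min ?lexx ?orbT //; lra.
have : 0 <= r * c by rewrite mulr_ge0 // ltW.
nra.
Qed.

End Resolvent.

Section Sequences.
Variables (R : realType) (X : normedModType R[i]).
Implicit Types u v : nat -> X.

Lemma continuous_nm_bound (f : {linear X -> X}) : continuous f ->
  exists2 K, 0 <= K & forall a, nm (f a) <= K * nm a.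
Proof.
move=> /linear_bounded_continuous/linear_boundedP/pinfty_ex_gt0[k k0 hk].
have kE : k = (complex.Re k)%:C by rewrite RRe_real // gtr0_real.
exists (complex.Re k); first by rewrite -lecR -kE ltW.
by move=> a; rewrite -lecR rmorphM /= -kE -!nmE; exact: hk.
Qed.

Definition limsup_le u (c : R) :=
  forall e, 0 < e -> exists M, forall n, (M <= n)%N -> nm (u n) <= c + e.

Lemma limsup_le_seminorm : @seminorm_rel R (nat -> X) limsup_le.
Proof.
split.
- by move=> e e0; exists 0 => n _; rewrite add0r (_ : 0 n = 0) // nm0 ltW.
- move=> u c uc; apply/ler_addgt0Pr => e /uc[M /(_ M (leqnn M))].
  exact: le_trans (nm_ge0 _).
- move=> u c d uc cd e /uc[M hM]; exists M => n /hM/le_trans; apply.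
  by rewrite lerD2r.
- move=> u v c d uc vd e e0; have e2 : 0 < e / 2 by rewrite divr_gt0.
  have [M hM] := uc _ e2; have [M' hM'] := vd _ e2.
  exists (maxn M M') => n; rewrite geq_max => /andP[/hM h /hM' h'].
  by apply: le_trans (nmD _ _) _; lra.
- move=> a u c uc e e0.
  have a0 := nm_ge0 a.
  have a1 : 0 < nm a + 1 by lra.
  have [M hM] := uc (e / (nm a + 1)) (divr_gt0 e0 a1).
  exists M => n /hM h; rewrite (_ : (a *: u) n = a *: u n) // nmZ.
  apply: le_trans (ler_wpM2l a0 h) _; rewrite mulrDr lerD2l.
  by rewrite mulrCA ger_pMr // ler_pdivrMr // mul1r; lra.
- move=> u c uc e e0; have e2 : 0 < e / 2 by rewrite divr_gt0.
  have [M hM] := uc _ e2 _ e2.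
  by exists M => n /hM; lra.
Qed.

Let HL := limsup_le_seminorm.

Lemma limsup_le_shift u c : limsup_le u c -> limsup_le (fun n => u n.+1) c.
Proof. by move=> uc e /uc[M hM]; exists M => n Mn; apply: hM; exact: leqW. Qed.

Lemma limsup_le_unshift u c : limsup_le (fun n => u n.+1) c -> limsup_le u c.
Proof. by move=> uc e /uc[M hM]; exists M.+1 => -[//|n] Mn; exact: hM. Qed.

Lemma limsup_le_comp (f : X -> X) K u c : 0 <= K ->
  (forall a, nm (f a) <= K * nm a) -> limsup_le u c ->
  limsup_le (fun n => f (u n)) (K * c).
Proof.
move=> K0 hf uc e e0; have K1 : 0 < K + 1 by lra.
have [M hM] := uc (e / (K + 1)) (divr_gt0 e0 K1).
exists M => n /hM h; apply: le_trans (hf _) _.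
apply: le_trans (ler_wpM2l K0 h) _; rewrite mulrDr lerD2l.
by rewrite mulrCA ger_pMr // ler_pdivrMr // mul1r; lra.
Qed.

Lemma limsup_le_off_circle (l : R[i]) v c d : nm l != 1 -> limsup_le v d ->
  limsup_le (fun n => l *: v n - v n.+1) c ->
  limsup_le v (`|nm l - 1|^-1 * c).
Proof.
move=> l1 vd yc; have l0 := nm_ge0 l.
have [lt1|gt1|/eqP] := ltgtP (nm l) 1; last by rewrite (negbTE l1).
  rewrite ltr0_norm ?subr_lt0 // opprB mulrC.
  apply: (seminorm_rel_contract HL _ vd); first by rewrite l0.
  move=> e ve; apply: limsup_le_unshift.
  have := seminorm_relB HL (seminorm_relZ HL l ve) yc.
  have -> : l *: v - (fun n => l *: v n - v n.+1) = fun n => v n.+1.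
    apply/funext => n; change (l *: v n - (l *: v n - v n.+1) = v n.+1).
    by rewrite opprB addrC addrNK.
  by rewrite [_ + c]addrC.
rewrite gtr0_norm ?subr_gt0 //.
have lne : l != 0 by rewrite -nm_gt0; lra.
have -> : (nm l - 1)^-1 * c = ((nm l)^-1 * c) / (1 - (nm l)^-1).
  have ln : nm l - 1 != 0 by rewrite subr_eq0.
  by field; rewrite ln gt_eqF // (lt_trans ltr01).
apply: (seminorm_rel_contract HL _ vd).
  by rewrite invr_ge0 l0 invf_lt1 //; lra.
move=> e ve.
have := seminorm_relZ HL l^-1 (seminorm_relD HL yc (limsup_le_shift ve)).
rewrite nmV mulrDr.
have -> // : l^-1 *: ((fun n => l *: v n - v n.+1) + (fun n => v n.+1)) = v.
apply/funext => n; change (l^-1 *: (l *: v n - v n.+1 + v n.+1) = v n).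
by rewrite addrNK scalerA mulVf // scale1r.
Qed.

Lemma nm_geometric_sum (a : R[i]) (f : nat -> X) c n : nm a < 1 -> 0 <= c ->
  (forall k, nm (f k) <= c) -> nm (\sum_(k < n) a ^+ k *: f k) <= c / (1 - nm a).
Proof.
move=> a1 c0; elim: n f => [|n IH] f hf.
  by rewrite big_ord0 nm0 divr_ge0 // subr_ge0 ltW.
rewrite big_ord_recl expr0 scale1r.
have -> : \sum_(i < n) a ^+ lift ord0 i *: f (lift ord0 i) =
    a *: \sum_(i < n) a ^+ i *: f i.+1.
  by rewrite scaler_sumr; apply: eq_bigr => i _; rewrite exprS scalerA.
apply: le_trans (nmD _ _) _; rewrite nmZ.
have := IH (fun k => f k.+1) (fun k => hf k.+1).
move=> /(ler_wpM2l (nm_ge0 a)) h.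
have -> : c / (1 - nm a) = c + nm a * (c / (1 - nm a)).
  by field; rewrite subr_eq0 gt_eqF.
exact: lerD.
Qed.

Lemma limsup_le_geometric (a : R[i]) u c : nm a < 1 -> limsup_le u c ->
  limsup_le (fun n => a ^+ n *: u n) 0.
Proof.
move=> a1 uc e e0; have c0 := seminorm_rel_ge0 HL uc.
have [M hM] := uc 1 ltr01.
have : (nm a ^+ n @[n --> \oo] --> (0 : R)) by apply: cvg_expr; rewrite ger0_norm ?nm_ge0.
have ec : 0 < e / (c + 1) by rewrite divr_gt0 //; lra.
move=> /cvgr0Pnorm_le/(_ _ ec)[M' _ hM'].
exists (maxn M M') => n; rewrite geq_max add0r => /andP[/hM h /hM' /= h'].
rewrite nmZ nmX; move: h'; rewrite ger0_norm ?exprn_ge0 ?nm_ge0 // => h'.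
have -> : e = e / (c + 1) * (c + 1) by field; rewrite gt_eqF //; lra.
by apply: ler_pM; rewrite ?exprn_ge0 ?nm_ge0.
Qed.

Lemma off_circle_solvable (l : R[i]) u c : nm l != 1 -> limsup_le u c ->
  exists v d, limsup_le v d /\ limsup_le (fun n => l *: v n - v n.+1 - u n) 0.
Proof.
move=> l1 uc; have l0 := nm_ge0 l; have c0 := seminorm_rel_ge0 HL uc.
have [M hM] := uc 1 ltr01.
have [lt1|gt1|/eqP] := ltgtP (nm l) 1; last by rewrite (negbTE l1).
  pose v := fix v n := if n is n'.+1 then l *: v n' - u n' else 0.
  pose A := nm (v M) + (c + 1) / (1 - nm l).
  exists v, A; split; last first.
    move=> e e0; exists 0 => n _.
    by rewrite /= opprB [l *: _ + _]addrC addrNK subrr nm0 add0r ltW.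
  have AE : (1 - nm l) * A = (1 - nm l) * nm (v M) + (c + 1).
    by rewrite /A; field; rewrite subr_eq0 gt_eqF.
  have vA k : nm (v (k + M)%N) <= A.
    elim: k => [|k IH].
      by rewrite add0n lerDl divr_ge0 //; lra.
    rewrite addSn; apply: le_trans (nmD _ _) _; rewrite nmN nmZ.
    have := hM (k + M)%N (leq_addl _ _).
    have := ler_wpM2l l0 IH; have := nm_ge0 (v M); nra.
  by move=> e e0; exists M => n Mn; have := vA (n - M)%N; rewrite subnK //; lra.
pose a := l^-1.
have lne : l != 0 by rewrite -nm_gt0; lra.
have a1 : nm a < 1 by rewrite nmV invf_lt1 //; lra.
(* Truncating the Neumann series at k < n makes it a finite sum, at the price
   of an error that decays geometrically. *)
pose v n := a *: \sum_(k < n) a ^+ k *: u (n + k)%N.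
exists v, (nm a * ((c + 1) / (1 - nm a))); split.
  move=> e e0; exists M => n Mn; rewrite nmZ.
  apply: le_trans (_ : nm a * ((c + 1) / (1 - nm a)) <= _); last by lra.
  rewrite ler_wpM2l ?nm_ge0 //.
  apply: (nm_geometric_sum n (f := fun k => u (n + k)%N)) => //; first by lra.
  by move=> k; apply: hM; exact: leq_trans (leq_addr _ _).
have uu : limsup_le (fun n => u (n + n)%N) c.
  by move=> e /uc[M' hM']; exists M' => n Mn; apply: hM'; exact: leq_trans (leq_addr _ _).
have uu1 : limsup_le (fun n => u (n + n.+1)%N) c.
  by move=> e /uc[M' hM']; exists M' => n Mn; apply: hM'; exact: leq_trans (leq_addr _ _).
have g0 := limsup_le_geometric a1 uu.
have g1 := seminorm_relZ HL a (limsup_le_geometric a1 uu1).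
have := seminorm_relN HL (seminorm_relD HL g0 g1); rewrite mulr0 addr0.
have <- // : (fun n => l *: v n - v n.+1 - u n) =
  - ((fun n => a ^+ n *: u (n + n)%N) + a *: (fun n => a ^+ n *: u (n + n.+1)%N)).
apply/funext => n.
change (l *: v n - v n.+1 - u n =
  - (a ^+ n *: u (n + n)%N + a *: (a ^+ n *: u (n + n.+1)%N))).
have := big_ord_recl n.+1 (fun k : 'I_n.+2 => a ^+ k *: u (n + k)%N)
  (idx := 0) (op := +%R).
rewrite 2!big_ord_recr /= expr0 scale1r addn0.
rewrite /v [l *: _]scalerA (mulfV lne : l * a = 1) scale1r scaler_sumr.
have -> : \sum_(i < n.+1) a *: (a ^+ i *: u (n.+1 + i)%N) =
    \sum_(i < n.+1) a ^+ bump 0 i *: u (n + bump 0 i)%N.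
  by apply: eq_bigr => i _; rewrite scalerA -exprS addSnnS.
set s1 := \sum_(i < n) _; set s2 := \sum_(i < n.+1) _ => E.
have -> : s1 - s2 - u n = - (a ^+ n *: u (n + n)%N + a ^+ n.+1 *: u (n + n.+1)%N).
  set p := a ^+ n *: u (n + n)%N in E *.
  set p' := a ^+ n.+1 *: u (n + n.+1)%N in E *.
  have s1E : s1 = u n + s2 - (p + p') by rewrite -E -addrA addrK.
  by apply/eqP; rewrite !subr_eq {1}s1E addrC addrA.
by rewrite exprS -scalerA.
Qed.

End Sequences.

Section ForwardDifference.
Variables (R : realType) (X : normedModType R[i]).

Definition forward_difference (u : nat -> X) : nat -> X :=
  fun n => u n.+1 - u n.

Fact forward_difference_linear : linear forward_difference.
Proof.
move=> a u v; apply/funext => n.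
change (a *: u n.+1 + v n.+1 - (a *: u n + v n) =
  a *: (u n.+1 - u n) + (v n.+1 - v n)).
by rewrite opprD addrACA scalerBr.
Qed.

HB.instance Definition _ := GRing.isLinear.Build R[i] (nat -> X) (nat -> X) _
  forward_difference forward_difference_linear.

Lemma scale_sub_difference (w : R[i]) (u : nat -> X) :
  w *: u - forward_difference u = fun n => (1 + w) *: u n - u n.+1.
Proof.
apply/funext => n.
change (w *: u n - (u n.+1 - u n) = (1 + w) *: u n - u n.+1).
by rewrite opprB addrA scalerDl scale1r [w *: _ + _]addrC.
Qed.

End ForwardDifference.

Section AsymptoticOrbits.
Variables (R : realType) (X : normedModType R[i]) (B : {linear X -> X}).
Hypothesis B_bounded : continuous B.
Hypothesis B_spectrum : spectrum B `&` unit_circle R `<=` [set 1].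

Let HL := @limsup_le_seminorm R X.
Let N : {linear (nat -> X) -> (nat -> X)} := @forward_difference R X.

Definition orbit_defect (u : nat -> X) : nat -> X := fun n => u n.+1 - B (u n).

Definition orbit_le (u : nat -> X) (c : R) :=
  limsup_le (orbit_defect u) 0 /\ limsup_le u c.

Let orbit_defectD u v :
  orbit_defect (u + v) = orbit_defect u + orbit_defect v.
Proof.
apply/funext => n.
change (u n.+1 + v n.+1 - B (u n + v n) =
  u n.+1 - B (u n) + (v n.+1 - B (v n))).
by rewrite linearD opprD addrACA.
Qed.

Let orbit_defectZ a u : orbit_defect (a *: u) = a *: orbit_defect u.
Proof.
apply/funext => n.
change (a *: u n.+1 - B (a *: u n) = a *: (u n.+1 - B (u n))).
by rewrite linearZ /= scalerBr.
Qed.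

Let orbit_defect_bounded u c : limsup_le u c ->
  exists d, limsup_le (orbit_defect u) d.
Proof.
move=> uc; have [K K0 hK] := continuous_nm_bound B_bounded.
exists (c + K * c).
exact: (seminorm_relB HL (limsup_le_shift uc) (limsup_le_comp K0 hK uc)).
Qed.

Let orbit_defect0 u : limsup_le u 0 -> limsup_le (orbit_defect u) 0.
Proof.
move=> u0; have [K K0 hK] := continuous_nm_bound B_bounded.
have := seminorm_relB HL (limsup_le_shift u0) (limsup_le_comp K0 hK u0).
by rewrite mulr0 addr0.
Qed.

Lemma orbit_le_seminorm : @seminorm_rel R (nat -> X) orbit_le.
Proof.
split.
- split; last exact: seminorm_rel0 HL.
  exact: orbit_defect0 (seminorm_rel0 HL).
- by move=> u c [_ /(seminorm_rel_ge0 HL)].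
- by move=> u c d [u0 uc] cd; split => //; exact: (seminorm_relW HL) uc cd.
- move=> u v c d [u0 uc] [v0 vd]; split; last exact: (seminorm_relD HL).
  by rewrite orbit_defectD; have := seminorm_relD HL u0 v0; rewrite addr0.
- move=> a u c [u0 uc]; split; last exact: (seminorm_relZ HL).
  by rewrite orbit_defectZ; have := seminorm_relZ HL a u0; rewrite mulr0.
- move=> u c h; split; first by have [] := h 1 ltr01.
  by apply: (seminorm_rel_closed HL) => e /h[].
Qed.

Lemma resolvent_on_circle (l : R[i]) : nm l = 1 -> l != 1 ->
  exists (S : {linear X -> X}) (K : R), [/\ 0 <= K,
    forall a, nm (S a) <= K * nm a, forall a, S (l *: a - B a) = a,
    forall a, l *: S a - B (S a) = a & forall a, S (B a) = B (S a)].
Proof.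
move=> l1 lne.
have : bounded_invertible (fun v : X => l *: v - B v).
  apply: contrapT => h; move/eqP: lne; apply.
  by apply: B_spectrum; split => //; rewrite /unit_circle /= nmE l1.
move=> [S [/continuous_nm_bound[K K0 hK] S1 S2]].
exists S, K; split => // a; rewrite -[a in LHS]S2.
by rewrite linearB [B (_ *: _)]linearZ S1.
Qed.

Lemma orbit_le_off1 (w : R[i]) : nm (1 + w) != 1 ->
  bounded_below orbit_le N w `|nm (1 + w) - 1|^-1.
Proof.
move=> w1 v c d [v0 vd] [_]; rewrite scale_sub_difference => h; split => //.
exact: limsup_le_off_circle w1 vd h.
Qed.

Lemma orbit_le_on1 (w : R[i]) : nm (1 + w) = 1 -> w != 0 ->
  exists2 K, 0 <= K & bounded_below orbit_le N w K.
Proof.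
move=> w1 w0.
have [|S [K [K0 hK SK _ _]]] := @resolvent_on_circle (1 + w) w1.
  by rewrite -subr_eq0 addrAC subrr add0r.
exists K => // v c d [v0 vd] [_]; rewrite scale_sub_difference => h; split => //.
have := limsup_le_comp K0 hK (seminorm_relD HL h v0); rewrite addr0.
have -> // : (fun n => S (((fun n => (1 + w) *: v n - v n.+1)
   + orbit_defect v) n)) = v.
apply/funext => n.
change (S ((1 + w) *: v n - v n.+1 + (v n.+1 - B (v n))) = v n).
by rewrite addrA addrNK SK.
Qed.

Lemma orbit_le_solvable (w : R[i]) u c : w != 0 -> orbit_le u c ->
  exists v d, orbit_le v d /\ orbit_le (w *: v - N v - u) 0.
Proof.
move=> w0 [u0 uc].
suff [v [d [[v0 vd] h]]] : exists v d, orbit_le v d /\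
    limsup_le (w *: v - N v - u) 0.
  by exists v, d; split => //; split => //; exact: orbit_defect0.
have [w1|w1] := eqVneq (nm (1 + w)) 1.
  have [|S [K [K0 hK _ SK SB]]] := @resolvent_on_circle (1 + w) w1.
    by rewrite -subr_eq0 addrAC subrr add0r.
  have v0 : limsup_le (orbit_defect (fun n => S (u n))) 0.
    have := limsup_le_comp K0 hK u0; rewrite mulr0.
    have -> // : (fun n => S (orbit_defect u n)) = orbit_defect (fun n => S (u n)).
    by apply/funext => n; rewrite /orbit_defect linearB SB.
  exists (fun n => S (u n)), (K * c); split.
    by split => //; exact: limsup_le_comp.
  rewrite scale_sub_difference; have := seminorm_relN HL v0.
  have -> // : - orbit_defect (fun n => S (u n)) =
    (fun n => (1 + w) *: S (u n) - S (u n.+1)) - u.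
  apply/funext => n.
  change (- (S (u n.+1) - B (S (u n))) = (1 + w) *: S (u n) - S (u n.+1) - u n).
  rewrite opprB -[X in _ = _ - X]SK [RHS]addrAC opprB.
  by rewrite [(1 + w) *: _ + _]addrC addrNK.
have [v [d [vd h]]] := off_circle_solvable w1 uc.
exists v, d; split; last by rewrite scale_sub_difference.
split => //; have [e ve] := orbit_defect_bounded vd.
have := seminorm_relD HL (orbit_defect0 h) u0; rewrite addr0 => h'.
rewrite -[0](mulr0 `|nm (1 + w) - 1|^-1).
apply: (limsup_le_off_circle w1 ve); move: h'.
have -> // : orbit_defect (fun n => (1 + w) *: v n - v n.+1 - u n) + orbit_defect u
  = fun n => (1 + w) *: orbit_defect v n - orbit_defect v n.+1.
rewrite -orbit_defectD; apply/funext => n.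
change ((1 + w) *: v n.+1 - v n.+2 - u n.+1 + u n.+1
   - B ((1 + w) *: v n - v n.+1 - u n + u n)
   = (1 + w) *: (v n.+1 - B (v n)) - (v n.+2 - B (v n.+1))).
by rewrite !addrNK linearB [B (_ *: _)]linearZ scalerBr opprD addrACA -opprD.
Qed.

Lemma orbit_le_bounded u c : orbit_le u c -> exists d, orbit_le (N u) d.
Proof.
move=> [u0 uc]; exists (c + c); split; last first.
  exact: (seminorm_relB HL (limsup_le_shift uc) uc).
have := seminorm_relB HL (limsup_le_shift u0) u0; rewrite addr0.
have -> // : (fun n => orbit_defect u n.+1) - orbit_defect u = orbit_defect (N u).
apply/funext => n.
change (u n.+2 - B (u n.+1) - (u n.+1 - B (u n)) =
  u n.+2 - u n.+1 - B (u n.+1 - u n)).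
by rewrite [B (_ - _)]linearB opprD addrACA -opprD.
Qed.

Lemma orbit_difference_small u c : orbit_le u c ->
  limsup_le (forward_difference u) 0.
Proof.
move=> uc.
by have [] := isometry_spectrum1 orbit_le_seminorm orbit_le_off1 orbit_le_on1
  orbit_le_solvable orbit_le_bounded uc.
Qed.

End AsymptoticOrbits.

Lemma limsup_le0_cvg (R : realType) (X : normedModType R[i]) (u : nat -> X) :
  limsup_le u 0 <-> u n @[n --> \oo] --> (0 : X).
Proof.
split.
  move=> u0; apply/cvgr0Pnorm_le => e e0.
  have eE : e = (complex.Re e)%:C by rewrite RRe_real // gtr0_real.
  have : 0 < complex.Re e by rewrite -ltcR -eE.
  by move=> /u0[M hM]; exists M => // n /hM; rewrite add0r nmE eE lecR.
move=> /cvgr0Pnorm_le h e e0.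
have eC : 0 < e%:C by rewrite ltcR.
by have [M _ hM] := h _ eC; exists M => n /hM; rewrite add0r /= nmE lecR.
Qed.

Theorem theorem2p1 (R : realType) (X : completeNormedModType R[i])
    (B : {linear X -> X}) (x y : nat -> X)
    (B_bounded : continuous B)
    (B_spectrum : spectrum B `&` unit_circle R `<=` [set 1])
    (y_cvg0 : y n @[n --> \oo] --> (0 : X))
    (x_bounded : [bounded x n | n in [set n | (1 <= n)%N]])
    (x_rec : forall n : nat, (1 <= n)%N -> x n.+1 = B (x n) + y n) :
  x n.+1 - x n @[n --> \oo] --> (0 : X).
Proof.
have [c xc] : exists c, limsup_le x c.
  have /ex_bound[|M hM] := x_bounded.
    exact: (@globally_properfilter _ [set n | (1 <= n)%N] 1).
  exists (complex.Re M) => e e0; exists 1 => n n1.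
  have /= := hM n n1; rewrite nmE lecE => /andP[_ /= h].
  by lra.
apply/limsup_le0_cvg.
apply: (orbit_difference_small B_bounded B_spectrum (c := c)); split => //.
move=> e /((limsup_le0_cvg y).2 y_cvg0)[M hM].
exists M.+1 => -[//|n] Mn; rewrite /orbit_defect x_rec // addrAC subrr add0r.
by apply: hM; exact: ltnW.
Qed.
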